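(* Let $R$ be an arbitrary (possibly non-commutative) ring with $1$ and let $A\in\mathrm{M}_3(R)$. Then $$\mathrm{sdet}(A)=\mathrm{tr}^{3}(A)-\mathrm{tr}(A)\cdot\mathrm{tr}(A^{2})-\mathrm{tr}(A\cdot\mathrm{tr}(A)\cdot A)-\mathrm{tr}(A^{2})\cdot\mathrm{tr}(A)+\mathrm{tr}(A^{3})+\mathrm{tr}\left((A^{\top})^{3}\right).$$ Moreover, if $R$ is commutative, then $\mathrm{sdet}(A)=6\det(A)$, $\mathrm{tr}(A)\mathrm{tr}(A^{2})=\mathrm{tr}(A\cdot\mathrm{tr}(A)\cdot A)=\mathrm{tr}(A^{2})\cdot\mathrm{tr}(A)$ and $\mathrm{tr}\left((A^{\top})^{3}\right)=\mathrm{tr}(A^{3})$.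
   Context: For $A=[a_{i,j}]\in\mathrm{M}_n(R)$, the symmetric determinant is $$\mathrm{sdet}(A)=\sum_{\alpha,\beta\in\mathrm{S}_n}\mathrm{sgn}(\alpha)\,\mathrm{sgn}(\beta)\,a_{\alpha(1),\beta(1)}a_{\alpha(2),\beta(2)}\cdots a_{\alpha(n),\beta(n)},$$ where $\mathrm{S}_n$ is the symmetric group on $\{1,\dots,n\}$. $\mathrm{tr}$ denotes the sum of the diagonal entries, $\mathrm{tr}^k(A)=(\mathrm{tr}(A))^k$, and $A^{\top}$ is the transpose of $A$. The product $A\cdot\mathrm{tr}(A)\cdot A$ means $A\,(\mathrm{tr}(A)I)\,A$, where $I$ is the identity matrix. *)

(* Defs.v *)
From mathcomp Require Import all_boot all_order all_algebra all_fingroup.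

Set Implicit Arguments.
Unset Strict Implicit.
Unset Printing Implicit Defensive.

Import GRing.Theory.
Local Open Scope ring_scope.

(* R need not be commutative: the factors of \prod_(i < n) are multiplied in
   increasing order of i, A (a 0) (b 0) * A (a 1) (b 1) * ... *)
Definition sdet (R : pzRingType) (n : nat) (A : 'M[R]_n) : R :=
  \sum_(a : 'S_n) \sum_(b : 'S_n)
    (-1) ^+ a * (-1) ^+ b * \prod_(i < n) A (a i) (b i).

(* Main.v *)
Require Import Defs.
From HB Require Import structures.
From mathcomp Require Import all_boot all_order all_algebra all_fingroup.
Import GRing.Theory.
Local Open Scope ring_scope.

(** Substituting [b = a \o s] in the symmetric determinant turns it into
    the signed sum over [s] of the words
    [A (a 0) (a (s 0)) * A (a 1) (a (s 1)) * ...], where [a] runs over the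
    bijective indexings. The key remark ([sdet_cycle_sums]) is that [a] may as
    well run over all maps: if [a i = a j] with [i != j], then [s] and
    [s * tperm i j] give the same word with opposite signs, so the words of a
    map that is not injective cancel in pairs. Once [a] is unconstrained, the
    sum for each [s] is an iterated trace, whose shape is given by the cycles
    of [s] and by the order in which the factors are multiplied. In size 3
    the identity gives [tr^3], the transpositions give the three terms with
    a minus sign, and the two 3-cycles give the traces of the cubes of [A] and of its
    transpose.

    Over a commutative ring the order of the factors is immaterial: for a fixed
    [a], the sum over [b] is the Leibniz formula for [\det A] with its factors
    reordered, hence [sdet A = n! \det A], and the remaining equalities are
    the standard properties of the trace. *)

(** The pairing of [s] with [s * tperm i j] gives cancellation in every
    characteristic, whereas the change of sign under this substitution would
    only show that twice the sum is zero. *)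
Lemma sum_sign_noninj (R : pzRingType) (n : nat) (T : Type) (f : 'I_n -> T)
    (i j : 'I_n) (B : 'I_n -> T -> R) :
  i != j -> f i = f j ->
  \sum_(s : 'S_n) (-1) ^+ s * \prod_(k < n) B k (f (s k)) = 0.
Proof.
move=> neq_ij eq_fij; set t := tperm i j.
have ft k : f (t k) = f k by rewrite /t; case: tpermP => // ->.
rewrite (bigID (@odd_perm _)) (reindex_inj (mulIg t)) /=.
apply/eqP; rewrite addr_eq0 -sumrN; apply/eqP.
apply: eq_big => [s | s _]; first by rewrite odd_permM odd_tperm neq_ij addbT.
rewrite odd_permM odd_tperm neq_ij signr_addb mulrN1 mulNr; congr (- (_ * _)).
by apply: eq_bigr => k _; rewrite permM ft.
Qed.

(** The sum over the bijections [a] is enlarged to all maps [f], at no cost by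
    [sum_sign_noninj]; free indices are what turns the words into traces. *)
Lemma sdet_cycle_sums (R : pzRingType) (n : nat) (A : 'M[R]_n) :
  sdet A = \sum_(s : 'S_n) (-1) ^+ s *
             \sum_(f : {ffun 'I_n -> 'I_n}) \prod_(i < n) A (f i) (f (s i)).
Proof.
under [RHS]eq_bigr do rewrite big_distrr /=.
rewrite exchange_big /= (bigID (fun f : {ffun 'I_n -> 'I_n} => injectiveb f)).
rewrite /= [X in _ + X]big1 ?addr0; last first.
  move=> f /injectivePn[i [j neq_ij eq_fij]].
  exact: (sum_sign_noninj _ _ _ _ _ _ (fun k => A (f k)) neq_ij eq_fij).
(* Permutations are, by construction, the injective finite functions. *)
rewrite (reindex (fun a : 'S_n => pval a)) /=; last first.
  exists (insubd (1%g : 'S_n)) => [a _ | f /= f_inj]; first exact: valKd.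
  exact: (insubdK (1%g : 'S_n)).
apply: eq_big => [a | a _]; first by case: a.
rewrite (reindex_inj (mulIg a)); apply: eq_bigr => s _.
rewrite odd_permM -signr_addb addbC addbK; congr (_ * _).
by apply: eq_bigr => k _; rewrite permM -!pvalE.
Qed.

(** For each of the [n!] permutations [a], replacing [b] by [a * b] and
    sorting the factors by their row index gives the Leibniz formula. *)
Lemma sdet_comm (R : comPzRingType) (n : nat) (A : 'M[R]_n) :
  sdet A = n`!%:R * \det A.
Proof.
rewrite -card_Sn -sumr_const mulr_suml.
apply: eq_bigr => a _; rewrite (reindex_inj (mulgI a)) mul1r.
apply: eq_bigr => b _; rewrite odd_permM -signr_addb addKb; congr (_ * _).
rewrite [RHS](reindex_inj (@perm_inj _ a)).
by apply: eq_bigr => i _; rewrite permM.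
Qed.

Local Notation t01 := (tperm (0 : 'I_3) 1).
Local Notation t02 := (tperm (0 : 'I_3) 2).
Local Notation t12 := (tperm (1 : 'I_3) 2).

Lemma sum_perm3 (V : nmodType) (F : 'S_3 -> V) :
  \sum_s F s =
    F 1%g + F t12 + F t02 + F t01
    + F (t01 * t02)%g + F (t02 * t01)%g.
Proof.
pose s6 : seq 'S_3 := [:: 1%g; t12; t02; t01; t01 * t02; t02 * t01]%g.
have uniq_s6 : uniq s6.
  (* The values at two points tell these permutations apart, and they
     compute. *)
  apply: (@map_uniq _ _ (fun s : 'S_3 => (s 0, s 1))).
  by rewrite /= !permM !permE /=.
(* Six distinct permutations exhaust 'S_3, which has 3! elements. *)
have s6_enum : perm_eq (enum 'S_3) s6.
  rewrite perm_sym; apply: uniq_perm; rewrite ?enum_uniq //.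
  have sub_s6 : {subset s6 <= enum 'S_3} by move=> s _; rewrite mem_enum.
  by case: (uniq_min_size uniq_s6 sub_s6); rewrite // -cardE card_Sn.
rewrite -[LHS]big_enum (perm_big _ s6_enum) /= !big_cons big_nil.
by rewrite addr0 !addrA.
Qed.

Lemma sum_ffun3 (V : nmodType) (T : finType) (F : T -> T -> T -> V) :
  \sum_(f : {ffun 'I_3 -> T}) F (f 0) (f 1) (f 2) =
    \sum_i \sum_j \sum_k F i j k.
Proof.
rewrite pair_big /= pair_big /=.
(* The default value [p.2] of [nth] is the value at 2. *)
pose mk (p : T * T * T) := [ffun i : 'I_3 => nth p.2 [:: p.1.1; p.1.2] i].
rewrite (reindex mk) /=; first by apply: eq_bigr => p _; rewrite !ffunE.
exists (fun f : {ffun _} => (f 0, f 1, f 2)) => [[[i j] k] _ | f _].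
  by rewrite !ffunE.
apply/ffunP=> -[[|[|[|//]]] lt_i]; rewrite ffunE /=; congr (f _); exact: val_inj.
Qed.

Lemma prod_ord3 (R : pzRingType) (F : 'I_3 -> R) :
  \prod_(i < 3) F i = F 0 * F 1 * F 2.
Proof.
rewrite !big_ord_recl big_ord0 mulr1 mulrA.
by congr (F _ * F _ * F _); apply: val_inj.
Qed.

(** One word for each permutation, in the order of the traces they become: the
    identity, the transpositions fixing 0, 1 and 2, then the two 3-cycles.
    The fixed point of a transposition is the place of its diagonal factor. *)
Lemma sdet3_words (R : pzRingType) (A : 'M[R]_3) :
  sdet A = \sum_i \sum_j \sum_k A i i * A j j * A k k
         - \sum_i \sum_j \sum_k A i i * A j k * A k j
         - \sum_i \sum_j \sum_k A i k * A j j * A k i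
         - \sum_i \sum_j \sum_k A i j * A j i * A k k
         + \sum_i \sum_j \sum_k A i j * A j k * A k i
         + \sum_i \sum_j \sum_k A i k * A j i * A k j.
Proof.
rewrite sdet_cycle_sums sum_perm3.
rewrite !odd_permM !odd_tperm odd_perm1 /= expr0 !mul1r !mulN1r.
rewrite -!sum_ffun3.
by congr (_ - _ - _ - _ + _ + _); apply: eq_bigr => f _;
  rewrite prod_ord3 ?permM !permE.
Qed.

Lemma tr_mx_mul (R : pzSemiRingType) (n : nat) (A B : 'M[R]_n) :
  \tr (A * B) = \sum_i \sum_j A i j * B j i.
Proof. by apply: eq_bigr => i _; rewrite mxE. Qed.

Lemma tr_mx_mul3 (R : pzSemiRingType) (n : nat) (A B C : 'M[R]_n) :
  \tr (A * B * C) = \sum_i \sum_j \sum_k A i j * B j k * C k i.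
Proof.
rewrite tr_mx_mul; apply: eq_bigr => i _; rewrite exchange_big /=.
by apply: eq_bigr => k _; rewrite mxE mulr_suml.
Qed.

Lemma tr_mx_mul_scalar_mul (R : pzSemiRingType) (n : nat) (A B : 'M[R]_n) c :
  \tr (A * c%:M * B) = \sum_i \sum_j A i j * c * B j i.
Proof.
rewrite tr_mx_mul; apply: eq_bigr => i _; apply: eq_bigr => j _.
by rewrite -mulmxE -diag_const_mx mul_mx_diag !mxE.
Qed.

Lemma sdet3_traces (R : pzRingType) (A : 'M[R]_3) :
  sdet A = (\tr A) ^+ 3 - \tr A * \tr (A ^+ 2) - \tr (A * (\tr A)%:M * A)
           - \tr (A ^+ 2) * \tr A + \tr (A ^+ 3) + \tr ((A^T) ^+ 3).
Proof.
rewrite sdet3_words !expr2 !exprSr !expr0 !mul1r.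
rewrite tr_mx_mul_scalar_mul !tr_mx_mul3 !tr_mx_mul.
congr (_ - _ - _ - _ + _ + _).
- rewrite /mxtrace !mulr_suml; apply: eq_bigr => i _.
  rewrite -mulrA mulr_suml mulr_sumr; apply: eq_bigr => j _.
  by rewrite !mulr_sumr; apply: eq_bigr => k _; rewrite mulrA.
- rewrite mulr_suml; apply: eq_bigr => i _.
  rewrite mulr_sumr; apply: eq_bigr => j _.
  by rewrite mulr_sumr; apply: eq_bigr => k _; rewrite mulrA.
- apply: eq_bigr => i _; rewrite exchange_big; apply: eq_bigr => k _ /=.
  by rewrite mulr_sumr mulr_suml.
- rewrite mulr_suml; apply: eq_bigr => i _.
  by rewrite mulr_suml; apply: eq_bigr => j _; rewrite mulr_sumr.
(* The cycle is read backwards here: the row index of the first factor is the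
   middle index of the cube of the transpose. *)
- rewrite [RHS]exchange_big; apply: eq_bigr => i _ /=.
  rewrite [RHS]exchange_big; apply: eq_bigr => j _ /=.
  by apply: eq_bigr => k _; rewrite !mxE.
Qed.

Lemma tr_mul_scalar_mul_comm (R : comPzRingType) (n : nat) (A : 'M[R]_n) c :
  \tr (A * c%:M * A) = c * \tr (A * A).
Proof. by rewrite -!mulmxE mul_mx_scalar -scalemxAl mxtraceZ. Qed.

Lemma tr_trmxX (R : comPzRingType) (n k : nat) (A : 'M[R]_n) :
  \tr (A^T ^+ k) = \tr (A ^+ k).
Proof.
suff -> : A^T ^+ k = (A ^+ k)^T by rewrite mxtrace_tr.
elim: k => [|k IHk]; first by rewrite !expr0 trmx1.
by rewrite exprS IHk exprSr -!mulmxE trmx_mul.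
Qed.

Theorem theorem6p2 (R : pzRingType) (A : 'M[R]_3) :
  sdet A = (\tr A) ^+ 3 - \tr A * \tr (A ^+ 2) - \tr (A * (\tr A)%:M * A)
           - \tr (A ^+ 2) * \tr A + \tr (A ^+ 3) + \tr ((A^T) ^+ 3)
  /\ ((forall x y : R, x * y = y * x) ->
      [/\ sdet A = 6 * \det A,
          \tr A * \tr (A ^+ 2) = \tr (A * (\tr A)%:M * A),
          \tr (A * (\tr A)%:M * A) = \tr (A ^+ 2) * \tr A
        & \tr ((A^T) ^+ 3) = \tr (A ^+ 3)]).
Proof.
split=> [|mulRC]; first exact: sdet3_traces.
(* The same ring, with its commutativity as part of the structure. *)
pose mulC := GRing.PzSemiRing_hasCommutativeMul.Build R mulRC.
pose cR : comPzRingType := HB.pack (GRing.PzRing.sort R) mulC.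
have trA3 : \tr (A * (\tr A)%:M * A) = \tr A * \tr (A ^+ 2).
  by rewrite expr2; exact: (@tr_mul_scalar_mul_comm cR).
split=> //; first exact: (@sdet_comm cR).
  by rewrite trA3 mulRC.
exact: (@tr_trmxX cR).
Qed.
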